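(* Let $\Sigma$ be a finite alphabet with $|\Sigma| \ge 2$, let $n \ge 1$, and let $x_1, \ldots, x_k \in \Sigma^*$ with $|x_i| \le n$ for $1 \le i \le k$. Let $S = \{x_1, \ldots, x_k\}$ and suppose $S^*$ is co-finite. Then $$|\Sigma^* \setminus S^*| \le \frac{|\Sigma|^q - 1}{|\Sigma| - 1}, \qquad \text{where } q = \frac{2}{2|\Sigma| - 1}\left(2^n|\Sigma|^n - 1\right).$$
   Context: A language $L \subseteq \Sigma^*$ is co-finite if $\Sigma^* \setminus L$ is finite. *)

(* Defs.v *)
From mathcomp Require Export all_boot all_order all_algebra.
From mathcomp Require Export finmap all_classical.

Set Implicit Arguments.
Unset Strict Implicit.
Unset Printing Implicit Defensive.

Import GRing.Theory Num.Theory.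

Local Open Scope classical_set_scope.

Definition language (Sigma : finType) := set (seq Sigma).

Definition kstar (Sigma : finType) (S : language Sigma) : language Sigma :=
  [set w | exists2 ws : seq (seq Sigma),
             (forall u, u \in ws -> S u) & w = flatten ws].

Definition cofinite (Sigma : finType) (L : language Sigma) : Prop :=
  finite_set (~` L).

(* The exponent q = 2 / (2s - 1) * (2^n s^n - 1).  It is an integer, since
   2s - 1 divides (2s)^n - 1, so the Euclidean division loses nothing: see
   [qexpE]. *)
Definition qexp (s n : nat) : nat :=
  (2 * (2 ^ n * s ^ n - 1)) %/ (2 * s - 1).

Lemma qexpE (s n : nat) : (0 < s)%N ->
  ((qexp s n)%:R = 2 / (2 * s%:R - 1) * (2 ^+ n * s%:R ^+ n - 1) :> rat)%R.
Proof.
move=> s0; rewrite /qexp -expnMn.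
have s2 : (0 < 2 * s)%N by rewrite muln_gt0.
have d0 : (0 < 2 * s - 1)%N by rewrite subn_gt0 (leq_pmulr 2 s0).
have dv : (2 * s - 1 %| 2 * ((2 * s) ^ n - 1))%N.
  by apply: dvdn_mull; rewrite !subn1 (predn_exp (2 * s) n) dvdn_mulr.
have e1 : ((2 * s - 1)%N%:R = 2 * s%:R - 1 :> rat)%R by rewrite natrB // natrM.
have e2 : (((2 * s) ^ n - 1)%N%:R = 2 ^+ n * s%:R ^+ n - 1 :> rat)%R.
  by rewrite natrB ?expn_gt0 ?s2 // natrX natrM exprMn.
have nz : (2 * s%:R - 1 != 0 :> rat)%R by rewrite -e1 pnatr_eq0 -lt0n.
apply: (mulIf nz); rewrite -[in LHS]e1 -[LHS]natrM divnK // natrM e2.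
by rewrite [RHS]mulrAC divfK.
Qed.

(* Main.v *)
Require Import Defs.

(** Reading a word [w], keep its last [n - 1] letters, each together with the
    bit telling whether the prefix preceding that letter is in [S^*], and the
    bit telling whether [w] itself is in [S^*].  Since all words of [S] have
    length at most [n], these data are updated deterministically, so they are
    the states of a DFA for [S^*]; there are
    [2 * \sum_(i < n) (2 * #|Sigma|) ^ i = q] of them.  If a longest word
    outside [S^*] had length at least [q], two of its prefixes would reach the
    same state, and repeating the factor between them would give a longer
    word outside [S^*].  Hence all words outside [S^*] have length below [q]. *)

Set Implicit Arguments.
Unset Strict Implicit.
Unset Printing Implicit Defensive.

Import Order.TTheory GRing.Theory Num.Theory.

Local Open Scope classical_set_scope.

Definition short_words (T : finType) (N : nat) : seq (seq T) :=
  flatten [seq [seq tval t | t <- enum {: i.-tuple T}] | i <- iota 0 N].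

Lemma mem_short_words (T : finType) (N : nat) (w : seq T) :
  size w < N -> w \in short_words T N.
Proof.
move=> ltwN; apply/flatten_mapP; exists (size w); first by rewrite mem_iota.
by apply/mapP; exists (in_tuple w); rewrite ?mem_enum.
Qed.

Lemma size_short_words (T : finType) (N : nat) :
  size (short_words T N) = \sum_(i < N) #|T| ^ i.
Proof.
rewrite /short_words size_flatten /shape -map_comp sumnE big_map.
rewrite -[N in LHS]subn0 -/(index_iota 0 N) big_mkord; apply: eq_bigr => i _ /=.
by rewrite size_map -cardE card_tuple.
Qed.

Lemma size_uniq_short (T : finType) (N : nat) (ws : seq (seq T)) :
  uniq ws -> {in ws, forall w, size w < N} -> size ws <= \sum_(i < N) #|T| ^ i.
Proof.
move=> uws ltN; rewrite -size_short_words.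
by apply: uniq_leq_size => // w /ltN /mem_short_words.
Qed.

Definition lastn (T : Type) (m : nat) (s : seq T) : seq T := drop (size s - m) s.

Lemma size_lastn (T : Type) (m : nat) (s : seq T) :
  size (lastn m s) = minn m (size s).
Proof. by rewrite size_drop minnC minnE. Qed.

Lemma lastn_cat (T : Type) (m : nat) (s1 s2 : seq T) :
  size s2 = m -> lastn m (s1 ++ s2) = s2.
Proof. by move=> <-; rewrite /lastn size_cat addnK drop_size_cat. Qed.

Lemma lastn_lastn (T : Type) (p m : nat) (s : seq T) :
  p <= m -> lastn p (lastn m s) = lastn p s.
Proof.
move=> le_pm; rewrite /lastn drop_drop size_drop; congr drop.
case: (leqP (size s) m) => [|/ltnW] le_m.
  by rewrite (eqP le_m) subn0 addn0.
by rewrite subKn // addnC addnBA // subnK.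
Qed.

(** A sliding window of fixed width can be updated from its own content and the new letter alone. *)
Lemma lastn_rcons_lastn (T : Type) (m : nat) (s : seq T) (a : T) :
  lastn m (rcons (lastn m s) a) = lastn m (rcons s a).
Proof.
case: (leqP (size s) m) => [le_m|/ltnW le_m].
  by rewrite {2}/lastn (eqP le_m) drop0.
rewrite -[in RHS](cat_take_drop (size s - m) s) rcons_cat -/(lastn m s).
rewrite /lastn size_cat -/(lastn m s) drop_cat size_rcons size_lastn.
rewrite (minn_idPl le_m) size_takel ?leq_subr // -addnBA // ltnNge leq_addr /=.
by rewrite addKn.
Qed.

Section StarAutomaton.

Variables (T : finType) (S : language T) (n : nat).
Hypothesis size_S : forall u, S u -> size u <= n.

Local Notation L := (kstar S).

(** Empty factors at the end of a factorization are discarded by induction; the last nonempty factor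
    then ends with [a]. *)
Lemma kstar_rcons_inv (w : seq T) (a : T) : L (rcons w a) ->
  exists v u, [/\ w = v ++ u, L v & S (rcons u a)].
Proof.
case=> ws; elim/last_ind: ws => [|ws u IH] Sws; first by case: (w).
have Sws' z : z \in ws -> S z by move=> zws; apply: Sws; rewrite mem_rcons inE zws orbT.
rewrite flatten_rcons; case/lastP: u Sws => [|u b] Sws.
  by rewrite cats0; apply: IH.
rewrite -rcons_cat => /rcons_inj[-> ->]; exists (flatten ws), u; split=> //.
  by exists ws.
by apply: Sws; rewrite mem_rcons mem_head.
Qed.

Lemma kstar_rcons (v u : seq T) (a : T) :
  L v -> S (rcons u a) -> L (rcons (v ++ u) a).
Proof.
case=> ws Sws -> Su; exists (rcons ws (rcons u a)).
  by move=> z; rewrite mem_rcons inE => /predU1P[->|/Sws].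
by rewrite flatten_rcons rcons_cat.
Qed.

(* [annot v w] annotates each letter of [w], read after [v], with membership
   in [L] of the prefix of [v ++ w] that precedes it. *)
Fixpoint annot (v w : seq T) : seq (T * bool) :=
  if w is a :: t then (a, `[< L v >]) :: annot (rcons v a) t else [::].

Lemma unzip1_annot (v w : seq T) : unzip1 (annot v w) = w.
Proof. by elim: w v => //= a w IH v; rewrite IH. Qed.

Lemma size_annot (v w : seq T) : size (annot v w) = size w.
Proof. by rewrite -{2}(unzip1_annot v w) size_map. Qed.

Lemma annot_cat (v w1 w2 : seq T) :
  annot v (w1 ++ w2) = annot v w1 ++ annot (v ++ w1) w2.
Proof.
elim: w1 v => /= [|a w1 IH] v; first by rewrite cats0.
by rewrite IH cat_rcons.
Qed.

Lemma annot_rcons (w : seq T) (a : T) :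
  annot [::] (rcons w a) = rcons (annot [::] w) (a, `[< L w >]).
Proof. by rewrite -cats1 annot_cat cats1. Qed.

Definition state (w : seq T) : seq (T * bool) * bool :=
  (lastn n.-1 (annot [::] w), `[< L w >]).

Lemma state_kstar (w w' : seq T) : state w = state w' -> L w -> L w'.
Proof. by case=> _ eqL /asboolP; rewrite eqL => /asboolP. Qed.

(** The last nonempty factor [rcons u a] has length at most [n], so [u] fits in the window of [n.-1]
    letters. Hence [w'] also ends with [u], and the shared bits show that the prefix before it is in
    [L]. *)
Lemma state_rcons_kstar (w w' : seq T) (a : T) :
  state w = state w' -> L (rcons w a) -> L (rcons w' a).
Proof.
move=> eqf /kstar_rcons_inv[v [u [def_w Lv Su]]].
have le_u : size u <= n.-1.
  by have := size_S Su; rewrite size_rcons; case: (n).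
have last_u : annot v u = lastn (size u) (annot [::] w').
  case: (eqf) => eq_last _.
  rewrite -(lastn_lastn _ le_u) -eq_last lastn_lastn // def_w annot_cat.
  by rewrite lastn_cat // size_annot.
(* A priori [w'] could be too short to contain [u]; comparing the lengths of both sides of [last_u]
   excludes this. *)
have le_uw' : size u <= size w'.
  apply/minn_idPl; have := congr1 size last_u.
  by rewrite size_lastn !size_annot => /esym.
have [v' [u' [def_w' size_u']]] : exists v' u', w' = v' ++ u' /\ size u' = size u.
  exists (take (size w' - size u) w'), (drop (size w' - size u) w').
  by rewrite cat_take_drop size_drop subKn.
have eq_annot : annot v u = annot v' u'.
  by rewrite last_u def_w' annot_cat lastn_cat // size_annot.
have eq_u : u' = u by rewrite -(unzip1_annot v' u') -eq_annot unzip1_annot.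
rewrite def_w' eq_u; apply: kstar_rcons => //.
(* The bit on the first letter of [u] records membership of the prefix. If [u] is empty there is no
   such letter, and the second component of the state takes over. *)
case: {le_u last_u le_uw' size_u'} u Su def_w eq_annot eq_u => [|b u] Su def_w.
  move=> _ eq_u; move: def_w'; rewrite eq_u cats0 => <-.
  by apply: (state_kstar eqf); rewrite def_w cats0.
move=> eq_annot eq_u; move: eq_annot; rewrite eq_u => -[eqL _].
by apply/asboolP; rewrite -eqL; apply/asboolP.
Qed.

Lemma state_rcons (w w' : seq T) (a : T) :
  state w = state w' -> state (rcons w a) = state (rcons w' a).
Proof.
move=> eqf; rewrite /state !annot_rcons; congr (_, _).
  case: (eqf) => eq_last ->.
  by rewrite -lastn_rcons_lastn eq_last lastn_rcons_lastn.
by apply: asbool_equiv_eq; split; apply: state_rcons_kstar.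
Qed.

Lemma state_cat (w w' u : seq T) :
  state w = state w' -> state (w ++ u) = state (w' ++ u).
Proof.
elim/last_ind: u => [|u a IH] eqf; first by rewrite !cats0.
by rewrite -!rcons_cat; apply/state_rcons/IH.
Qed.

Definition state_bound : nat := 2 * \sum_(i < n) (2 * #|T|) ^ i.

Lemma state_pigeonhole (w : seq T) : 0 < n -> state_bound <= size w ->
  exists i j, [/\ i < j, j <= size w & state (take i w) = state (take j w)].
Proof.
move=> n_gt0 le_w.
pose states := [seq (s, b) | s <- short_words (T * bool)%type n, b <- [:: true; false]].
(* Counting the empty prefix, there is one more prefix than letters, so length [state_bound] already
   forces a repetition. *)
pose fs := [seq state (take i w) | i <- iota 0 (size w).+1].
have size_states : size states = state_bound.
  rewrite size_allpairs size_short_words mulnC /state_bound.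
  by congr (_ * _); apply: eq_bigr => i _; rewrite card_prod card_bool mulnC.
have fs_states : {subset fs <= states}.
  move=> _ /mapP[i _ ->]; apply: allpairs_f; last by case: `[< _ >].
  by apply: mem_short_words; rewrite size_lastn (leq_ltn_trans (geq_minl _ _)) ?ltn_predL.
have Nuniq : ~~ uniq fs.
  apply/negP => /uniq_leq_size /(_ fs_states).
  by rewrite size_states size_map size_iota leqNgt ltnS le_w.
have [i [j [ltij]]] := uniqPn (state [::]) Nuniq.
rewrite size_map size_iota => ltj; have lti := ltn_trans ltij ltj.
rewrite !(nth_map 0) ?size_iota // !nth_iota //.
by move=> eqf; exists i, j.
Qed.

Lemma size_cofinite_kstar (w : seq T) :
  0 < n -> cofinite L -> ~ L w -> size w < state_bound.
Proof.
move=> n_gt0 finL NLw; rewrite ltnNge; apply/negP => le_w.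
(* Pumping preserves the lower bound on the length, so it can be iterated to reach any length
   [m]. *)
have longer m : exists z, [/\ ~ L z, state_bound <= size z & m <= size z].
  elim: m => [|m [z [NLz le_z le_mz]]]; first by exists w.
  have [i [j [ltij lej eqf]]] := state_pigeonhole n_gt0 le_z.
  have lt_z : size z < size (take j z ++ drop i z).
    rewrite -[in X in X < _](cat_take_drop i z) !size_cat ltn_add2r.
    by rewrite !size_takel // (leq_trans (ltnW ltij)).
  exists (take j z ++ drop i z); split.
  - apply: contra_not NLz; apply: state_kstar.
    by rewrite -[in RHS](cat_take_drop i z); apply/esym/state_cat.
  - exact: leq_trans le_z (ltnW lt_z).
  - exact: leq_ltn_trans le_mz lt_z.
(* A word outside [L] longer than every word outside [L] is the contradiction. *)
have [z [NLz _]] := longer (\max_(z <- fset_set (~` L)) size z).+1.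
rewrite ltnNge (leq_bigmax_seq (F := size)) //.
by rewrite in_fset_set // inE.
Qed.

End StarAutomaton.

(** A geometric sum of ratio [2 * s]; with [s] the alphabet size, it identifies the exponent with
    [state_bound]. *)
Lemma qexp_sum (s n : nat) : 0 < s -> qexp s n = 2 * \sum_(i < n) (2 * s) ^ i.
Proof.
move=> s_gt0; rewrite /qexp -expnMn !subn1 predn_exp mulnCA mulKn //.
by rewrite -subn1 subn_gt0 (leq_pmulr 2 s_gt0).
Qed.

Local Open Scope ring_scope.

Theorem theorem26 (Sigma : finType) (n k : nat) (x : 'I_k -> seq Sigma)
    (hSigma : (2 <= #|Sigma|)%N) (hn : (1 <= n)%N)
    (hx : forall i : 'I_k, (size (x i) <= n)%N)
    (hcof : cofinite (kstar (range x))) :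
  (#|` fset_set (~` kstar (range x))|%fset)%:R
    <= (#|Sigma|%:R ^+ qexp #|Sigma| n - 1) / (#|Sigma|%:R - 1) :> rat.
Proof.
have size_S u : range x u -> (size u <= n)%N by case=> i _ <-.
have card_gt0 : (0 < #|Sigma|)%N by apply: ltnW.
have den_gt0 : 0 < #|Sigma|%:R - 1 :> rat by rewrite subr_gt0 ltr1n.
(* The bound is the number of words of length below the exponent, summed by length. *)
have -> : (#|Sigma|%:R ^+ qexp #|Sigma| n - 1) / (#|Sigma|%:R - 1)
    = (\sum_(i < qexp #|Sigma| n) #|Sigma| ^ i)%N%:R :> rat.
  rewrite subrX1 mulrAC divff ?gt_eqF // mul1r natr_sum.
  by apply: eq_bigr => i _; rewrite natrX.
rewrite ler_nat; apply: size_uniq_short; first exact: fset_uniq.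
move=> w; rewrite in_fset_set // inE => NLw; rewrite qexp_sum //.
exact: (size_cofinite_kstar size_S).
Qed.
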